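(* Let $\mathcal T=(\mathcal V,\mathcal E)$ be a finite tree. Then $\mathcal T$ satisfies the neighbour sum property if and only if there exists a vertex $v_0\in\mathcal V$ such that $S_{1,k}(v_0)=1$.
   Context: A graph $\mathcal G=(\mathcal V,\mathcal E)$ (simple, undirected, every vertex of finite degree) satisfies the neighbour sum property if there exists a function $f:\mathcal V\to\mathbb R$ with $f\not\equiv 0$ such that $f(x)=\sum_{y:\{x,y\}\in\mathcal E} f(y)$ for every $x\in\mathcal V$ (an empty sum is $0$). Definition of $S_{1,k}(v_0)$: root the finite tree at $v_0$, so every vertex $v\neq v_0$ has a unique parent (its neighbour on the path to $v_0$) and the children of a vertex $v$ are its neighbours other than its parent; $k$ denotes the length of the longest path starting at $v_0$. Define recursively a value $S(v)\in\mathbb R\cup\{\infty\}$ for every vertex: if $v$ has no children, $S(v)=0$; otherwise $S(v)=\sum_{c \text{ child of } v}(1-S(c))^{-1}$. Then $S_{1,k}(v_0):=S(v_0)$; explicitly, $S_{1,k}(v_0)=\sum_{r_1}\bigl(1-\sum_{r_2}(1-\cdots\sum_{r_{k-1}}(1-\sum_{r_k}1)^{-1}\cdots)^{-1}\bigr)^{-1}$, where $\sum_{r_{j}}$ runs over the children of the current vertex at distance $j-1$ from $v_0$. The computation uses the formal conventions $\tfrac10=\infty$, $\tfrac{r}{\pm\infty}=0$ for $r\in\mathbb R$, and $r\pm\infty=\pm\infty$ for $r\in\mathbb R$ (so in particular $1-\infty=-\infty$ and $(-\infty)^{-1}=0$, and a sum containing an infinite term is infinite). *)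

(* Defs.v *)
From mathcomp Require Import all_boot all_order all_algebra.
From mathcomp Require Import boolp reals constructive_ereal.

Set Implicit Arguments.
Unset Strict Implicit.
Unset Printing Implicit Defensive.

Import GRing.Theory.
Local Open Scope ring_scope.

Definition simple_graph (V : finType) (e : rel V) : Prop :=
  symmetric e /\ irreflexive e.

(* Connected and without cycles of length at least 3.  Nonemptiness is not
   required: both sides of the theorem are false on the empty vertex set. *)
Definition tree (V : finType) (e : rel V) : Prop :=
  [/\ simple_graph e, forall x y, connect e x y
    & forall c : seq V, (2 < size c)%N -> ~ ucycle e c].

Definition neighbour_sum_property (R : realType) (V : finType) (e : rel V) :
    Prop :=
  exists f : V -> R, (exists x, f x != 0) /\
    forall x, f x = \sum_(y | e x y) f y.

Section RootedTree.
Variables (V : finType) (e : rel V) (v0 : V).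

Definition is_parent (v p : V) : Prop :=
  exists s : seq V,
    [/\ path e v (p :: s), uniq (v :: p :: s) & last p s = v0].

Definition child (v c : V) : bool := e v c && ~~ `[< is_parent v c >].

End RootedTree.

(* Differs from the library inverse on \bar R, for which -oo^-1 = -oo;
   the convention here is r / +oo = r / -oo = 0. *)
Definition einv (R : realType) (x : \bar R) : \bar R :=
  if x is r%:E then (if r == 0 then +oo%E else r^-1%:E) else 0%E.

Section RootedSum.
Variables (R : realType) (V : finType) (e : rel V) (v0 : V).

(* The number n bounds the depth of the recursion.  All summands lie in
   R `|` {+oo}, so that a sum is +oo as soon as one of its terms is. *)
Fixpoint S_rec (n : nat) (v : V) : \bar R :=
  if n is n'.+1 then
    (\sum_(c | child e v0 v c) einv (1 - S_rec n' c))%E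
  else 0%E.

(* #|V| exceeds the length of every path, so the bound is never reached in a
   tree; see S_recursion. *)
Definition S_val (v : V) : \bar R := S_rec #|V| v.

End RootedSum.

Definition S1k (R : realType) (V : finType) (e : rel V) (v0 : V) : \bar R :=
  S_val R e v0 v0.

Lemma child_path (V : finType) (e : rel V) (v0 v c : V) (s : seq V) :
  tree e -> path e v s -> uniq (v :: s) -> last v s = v0 ->
  child e v0 v c -> path e c (v :: s) /\ uniq [:: c, v & s].
Proof.
move=> [[esym eirr] _ acyc] pvs uvs lvs /andP[evc /asboolPn nparent].
have ecv : e c v by rewrite esym.
split; first by rewrite /= ecv.
rewrite cons_uniq uvs andbT inE negb_or; apply/andP; split.
  by apply: contraTneq evc => ->; rewrite eirr.
apply/negP => cs; case/splitPr: cs pvs uvs lvs => [[|x s1] s2] pvs uvs lvs.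
  by apply: nparent; exists s2; split.
apply: (acyc (v :: rcons (x :: s1) c)); first by rewrite /= size_rcons.
move: pvs uvs; rewrite -cat_rcons cat_path -cat_cons cat_uniq.
move=> /andP[p1 _] /and3P[u1 _ _].
by rewrite /ucycle u1 andbT /cycle rcons_path p1 last_rcons.
Qed.

Lemma S_rec_stable (R : realType) (V : finType) (e : rel V) (v0 v : V)
    (n : nat) (s : seq V) :
  tree e -> path e v s -> uniq (v :: s) -> last v s = v0 ->
  (#|V| - size s <= n)%N -> S_rec R e v0 n v = S_rec R e v0 n.+1 v.
Proof.
move=> te; elim: n v s => [|n IHn] v s pvs uvs lvs.
  rewrite leqn0 subn_eq0 => le_Vs.
  by have := max_card (mem (v :: s)); rewrite (card_uniqP uvs) ltnNge le_Vs.
move=> le_n /=; apply: eq_bigr => c cvc.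
have [pc uc] := child_path te pvs uvs lvs cvc.
by rewrite (IHn c (v :: s)) //= subnS -subn1 leq_subLR add1n.
Qed.

Lemma S_recursion (R : realType) (V : finType) (e : rel V) (v0 v : V) :
  tree e ->
  S_val R e v0 v = (\sum_(c | child e v0 v c) einv (1 - S_val R e v0 c))%E.
Proof.
move=> te; have [_ conn _] := te.
have /connectP[p pvp lvp] := conn v v0.
case/shortenP: pvp lvp => s pvs uvs _ lvs.
by rewrite /S_val (@S_rec_stable R V e v0 v _ s) ?leq_subr.
Qed.

(* Main.v *)
(** Root the tree at v0.  If f satisfies the neighbour sum equations below v,
    then bottom-up the sum of f over the children of v is S(v) f(v) when S(v)
    is finite, while S(v) = oo forces f(v) = 0.  Rooting at any vertex where f
    is nonzero therefore gives S(v0) = 1.  Conversely, if S(v0) = 1, a solution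
    is built top-down from f(v0) = 1 by f(c) = f(v) / (1 - S(c)).  When
    S(c) = oo this gives f(c) = 0, and the equation at c is repaired by putting
    -f(v) on one chosen child d of c with S(d) = 1, and 0 on the other ones. *)
Require Import Defs.
From mathcomp Require Import all_boot all_order all_algebra.
From mathcomp Require Import boolp reals constructive_ereal.
From mathcomp Require Import ring.

Set Implicit Arguments.
Unset Strict Implicit.
Unset Printing Implicit Defensive.

Import Order.TTheory GRing.Theory Num.Theory.
Local Open Scope ring_scope.

(** * Parents, root paths and induction in a rooted tree *)

Section RootedTreeTheory.
Variables (V : finType) (e : rel V) (v0 : V).
Hypothesis te : tree e.

Lemma exists_root_path (v : V) :
  exists s, [/\ path e v s, uniq (v :: s) & last v s = v0].
Proof.
have [_ conn _] := te; have /connectP[p pvp lvp] := conn v v0.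
by case/shortenP: pvp lvp => s pvs uvs _ lvs; exists s.
Qed.

Lemma root_no_parent (p : V) : ~ is_parent e v0 v0 p.
Proof. by case=> s [_ /= /andP[+ _] ls]; rewrite -{1}ls mem_last. Qed.

(* Two parents of v are joined by a path avoiding v, which v closes up into a
   cycle. *)
Lemma parent_uniq (v p q : V) :
  is_parent e v0 v p -> is_parent e v0 v q -> p = q.
Proof.
have [[esym _] _ acyc] := te.
pose e' := [rel x y | [&& e x y, x != v & y != v]].
have e'sym : connect_sym e'.
  by apply: sym_connect_sym => x y /=; rewrite esym; congr (_ && _); rewrite andbC.
have to_root r : is_parent e v0 v r -> [/\ e v r, r != v & connect e' r v0].
  case=> s [/= /andP[evr prs] /and3P[vrs _ _] ls]; split=> //.
    by move: vrs; rewrite inE negb_or eq_sym => /andP[].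
  apply/connectP; exists s => //.
  elim: s r prs vrs {evr ls} => //= x s IHs r /andP[erx pxs].
  rewrite !inE !negb_or => /and3P[vr vx vs].
  by rewrite erx eq_sym vr eq_sym vx /= IHs // inE negb_or vx.
move=> /to_root[evp pv cp] /to_root[evq qv cq]; apply/eqP/negPn/negP => pq.
have : connect e' p q by apply: connect_trans cp _; rewrite e'sym.
case/connectP=> s0 /shortenP[s pps ups _] lq.
have vs : v \notin p :: s.
  rewrite inE negb_or eq_sym pv /=; apply/negP => vs.
  by case/splitPr: vs pps => s1 s2; rewrite cat_path /= eqxx !andbF.
apply: (acyc (v :: p :: s)).
  by case: s lq {pps ups vs} => //= qp; rewrite qp eqxx in pq.
rewrite /ucycle cons_uniq vs ups /= andbT rcons_path evp -lq esym evq andbT /=.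
by apply: sub_path pps => x y /= /and3P[].
Qed.

(** The first step of either path is a parent of [v], hence the same; an empty path means [v] is the
    root, which has no parent. *)
Lemma root_path_uniq (v : V) (s t : seq V) :
  path e v s -> uniq (v :: s) -> last v s = v0 ->
  path e v t -> uniq (v :: t) -> last v t = v0 -> s = t.
Proof.
elim: s v t => [|p s IHs] v [|q t] // pvs uvs lvs pvt uvt lvt.
- case: (@root_no_parent q); exists t; split=> //.
    by move: pvt; rewrite [v]lvs.
  by move: uvt; rewrite [v]lvs.
- case: (@root_no_parent p); exists s; split=> //.
    by move: pvs; rewrite [v]lvt.
  by move: uvs; rewrite [v]lvt.
have pq : p = q by apply: (@parent_uniq v); [exists s | exists t].
rewrite -{q}pq in pvt uvt lvt *.
move: pvs uvs pvt uvt => /andP[_ ps] /andP[_ us] /andP[_ pt] /andP[_ ut].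
by congr cons; apply: IHs pt ut lvt.
Qed.

Lemma child_is_parent (v c : V) : child e v0 v c -> is_parent e v0 c v.
Proof.
move=> cvc; have [s [ps us ls]] := exists_root_path v.
by exists s; have [] := child_path te ps us ls cvc.
Qed.

(** Passing to a child lengthens the root path by one, and a duplicate-free root path has fewer than
    [#|V|] edges, so [#|V| - size s] decreases. *)
Lemma tree_ind (P : V -> Prop) :
  (forall v, (forall c, child e v0 v c -> P c) -> P v) -> forall v, P v.
Proof.
move=> IH v; have [s [ps us ls]] := exists_root_path v.
have [n] : exists n, (#|V| - size s <= n)%N by exists #|V|; apply: leq_subr.
elim: n v s ps us ls => [|n IHn] v s ps us ls.
  rewrite leqn0 subn_eq0 => le_Vs.
  by have := max_card (mem (v :: s)); rewrite (card_uniqP us) ltnNge le_Vs.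
move=> le_n; apply: IH => c cvc.
have [pc uc] := child_path te ps us ls cvc.
by apply: (IHn c (v :: s)) => //=; rewrite subnS -subn1 leq_subLR add1n.
Qed.

Lemma root_neighbour_sum (R : realType) (f : V -> R) :
  \sum_(y | e v0 y) f y = \sum_(c | child e v0 v0 c) f c.
Proof.
apply: eq_bigl => y; rewrite /child asboolF ?andbT //.
exact: root_no_parent.
Qed.

Lemma nonroot_neighbour_sum (R : realType) (f : V -> R) (v p : V) :
  is_parent e v0 v p ->
  \sum_(y | e v y) f y = f p + \sum_(c | child e v0 v c) f c.
Proof.
move=> vp; have evp : e v p by case: vp => s [/andP[]].
rewrite (bigD1 p) //=; congr (_ + _); apply: eq_bigl => y; congr (_ && ~~ _).
by apply/eqP/asboolP => [-> //|vy]; apply: parent_uniq vy vp.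
Qed.

(** * The values S(v) and the constraints they put on a solution *)

Section Values.
Variable R : realType.
Local Notation S := (S_val R e v0).

Definition weight (c : V) : R := fine (einv (1 - S c)%E).

(** With no term equal to -oo, an extended sum is +oo exactly when one of its terms is. *)
Lemma einv_1sub_neqNy (x : \bar R) : einv (1 - x)%E != -oo%E.
Proof. by case: x => [r| |] //=; case: ifP. Qed.

Lemma einv_1sub_eqy (x : \bar R) : (einv (1 - x)%E == +oo%E) = (x == 1%:E).
Proof.
case: x => [r| |] //=; rewrite subr_eq0 eqe [r == 1]eq_sym.
by case: (1 == r).
Qed.

Lemma S_eqy (v c : V) : child e v0 v c -> S c = 1%:E -> S v = +oo%E.
Proof.
move=> cvc Sc; rewrite S_recursion //; apply/eqP.
rewrite esum_eqy => [|d _]; last exact: einv_1sub_neqNy.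
by apply/existsP; exists c; apply/andP; split; rewrite // einv_1sub_eqy Sc.
Qed.

Lemma S_fin (v : V) : (forall c, child e v0 v c -> S c <> 1%:E) ->
  S v = (\sum_(c | child e v0 v c) weight c)%:E.
Proof.
move=> ne1; rewrite S_recursion // -sumEFin; apply: eq_bigr => c cvc.
rewrite /weight fineK // fin_numE einv_1sub_neqNy einv_1sub_eqy /=.
exact/eqP/ne1.
Qed.

Lemma S_cases (v : V) :
  (exists c, [/\ child e v0 v c, S c = 1%:E & S v = +oo%E]) \/
  (forall c, child e v0 v c -> S c <> 1%:E) /\
    S v = (\sum_(c | child e v0 v c) weight c)%:E.
Proof.
have [[c [cvc Sc]]|nex] := pselect (exists c, child e v0 v c /\ S c = 1%:E).
  by left; exists c; split=> //; apply: S_eqy cvc Sc.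
have ne1 c : child e v0 v c -> S c <> 1%:E by move=> cvc Sc; apply: nex; exists c.
by right; split=> //; apply: S_fin.
Qed.

Lemma weight_pinfty (c : V) : S c = +oo%E -> weight c = 0.
Proof. by rewrite /weight => ->. Qed.

Lemma weight_fin (c : V) (r : R) :
  S c = r%:E -> S c <> 1%:E -> (1 - r) * weight c = 1.
Proof.
rewrite /weight => -> /eqP; rewrite eqe eq_sym -subr_eq0 => r1 /=.
by rewrite (negPf r1) /= divff.
Qed.

Lemma neighbour_sum_children (f : V -> R) :
  (forall x, f x = \sum_(y | e x y) f y) ->
  forall v, (S v = +oo%E -> f v = 0) /\
    (forall r, S v = r%:E -> \sum_(c | child e v0 v c) f c = r * f v).
Proof.
move=> fS; apply: tree_ind => v IH.
have fc c : child e v0 v c -> f c = f v + \sum_(d | child e v0 c d) f d.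
  by move/child_is_parent => vc; rewrite fS (nonroot_neighbour_sum f vc).
have [[c [cvc Sc Sv]]|[ne1 Sv]] := S_cases v; rewrite {}Sv; split=> //.
  (* As S(c) = 1, the children of [c] sum to f(c), so the equation at [c] reads f(c) = f(v) +
     f(c). *)
  have := fc _ cvc; have [_ /(_ _ Sc) ->] := IH _ cvc.
  by rewrite mul1r -[LHS]add0r => /addIr ->.
move=> r [<-]; rewrite mulr_suml; apply: eq_bigr => c cvc.
have := fc _ cvc; have [f0 fr] := IH _ cvc; have := ne1 c cvc.
have [[d [_ _ Sc]] _ _|[_ Sc] nSc] := S_cases c.
  by rewrite f0 // weight_pinfty // mul0r.
(* The equation at [c] becomes f(v) = (1 - S(c)) f(c), which the weight inverts. *)
rewrite (fr _ Sc); set t := \sum_(d | _) _ => fcE.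
have -> : f v = (1 - t) * f c by rewrite mulrBl mul1r {1}fcE addrK.
by rewrite mulrA [weight c * _]mulrC (weight_fin Sc nSc) mul1r.
Qed.

(** * Construction of a solution from the root downwards *)

Definition root_path (v : V) : seq V := projT1 (cid (exists_root_path v)).

Lemma root_pathP (v : V) :
  [/\ path e v (root_path v), uniq (v :: root_path v)
    & last v (root_path v) = v0].
Proof. by rewrite /root_path; case: cid. Qed.

(** Uniqueness of root paths makes the chosen ones compatible, so [path_value] unfolds along
    edges. *)
Lemma root_path_child (v c : V) :
  child e v0 v c -> root_path c = v :: root_path v.
Proof.
move=> cvc; have [pv uv lv] := root_pathP v; have [pc uc lc] := root_pathP c.
have [pcv ucv] := child_path te pv uv lv cvc.
exact: root_path_uniq pc uc lc pcv ucv lv.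
Qed.

Lemma root_path_root : root_path v0 = [::].
Proof.
have [pv uv lv] := root_pathP v0.
exact: (@root_path_uniq v0).
Qed.

Lemma root_path_is_parent (v : V) :
  v <> v0 -> exists2 q, is_parent e v0 v q & root_path v = q :: root_path q.
Proof.
have [] := root_pathP v; case: (root_path v) => [|q s] // pv uv lv _.
exists q; first by exists s.
have [pq uq lq] := root_pathP q.
move: pv uv => /andP[_ ps] /andP[_ us].
by congr cons; apply: root_path_uniq ps us lv pq uq lq.
Qed.

Definition chosen_child (v : V) : option V :=
  [pick c | child e v0 v c && (S c == 1%:E)].

(* The value at v of the solution, where s is the path from v to the root. *)
Fixpoint path_value (v : V) (s : seq V) : R :=
  if s is p :: s' then
    if S v == 1%:E then
      if chosen_child p == Some v then
        (* The default 0 would need a root with infinite S, which S(v0) = 1 rules out. *)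
        - (if s' is q :: s'' then path_value q s'' else 0)
      else 0
    else weight v * path_value p s'
  else 1.

Definition solution (v : V) : R := path_value v (root_path v).

Lemma solution_root : solution v0 = 1.
Proof. by rewrite /solution root_path_root. Qed.

Lemma solution_nonroot (v p : V) : root_path v = p :: root_path p ->
  S v <> 1%:E -> solution v = weight v * solution p.
Proof. by rewrite /solution => -> /eqP/negPf /= ->. Qed.

Lemma solution_child (v q c : V) : root_path v = q :: root_path q ->
  child e v0 v c -> S c = 1%:E ->
  solution c = if chosen_child v == Some c then - solution q else 0.
Proof.
by move=> vq cvc Sc; rewrite {1}/solution (root_path_child cvc) /= Sc eqxx vq.
Qed.

Lemma solution_sum_fin (v : V) (r : R) : S v = r%:E ->
  \sum_(c | child e v0 v c) solution c = r * solution v.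
Proof.
have [[c [_ _ ->]] //|[ne1 ->] [<-]] := S_cases v.
rewrite mulr_suml; apply: eq_bigr => c cvc.
by rewrite (solution_nonroot (root_path_child cvc)) //; apply: ne1.
Qed.

(** Only the chosen child contributes: other children with S = 1 get 0, and the rest get a multiple
    of [solution v], which is 0. *)
Lemma solution_sum_pinfty (v q : V) : root_path v = q :: root_path q ->
  S v = +oo%E ->
  \sum_(c | child e v0 v c) solution c = - solution q.
Proof.
move=> vq Sv.
have v_0 : solution v = 0.
  by rewrite (solution_nonroot vq) ?Sv // weight_pinfty // mul0r.
have fc := solution_child vq.
have [[d [dvd Sd _]]|[_]] := S_cases v; last by rewrite Sv.
move: fc; rewrite /chosen_child; case: pickP => [c /andP[cvc /eqP Sc] fc|].
  rewrite (bigD1 c) //= fc // eqxx big1 ?addr0 // => b /andP[bvb bc].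
  have [Sb|Sb] := eqVneq (S b) 1%:E.
    rewrite fc //; case: eqP => // -[cb]; by rewrite cb eqxx in bc.
  by rewrite (solution_nonroot (root_path_child bvb)) ?v_0 ?mulr0 //; apply/eqP.
by move/(_ d); rewrite dvd Sd eqxx.
Qed.

Lemma solution_neighbour_sum : S v0 = 1%:E ->
  forall v, solution v = \sum_(y | e v y) solution y.
Proof.
move=> S0 v; have [->|/eqP vv0] := eqVneq v v0.
  by rewrite root_neighbour_sum (solution_sum_fin S0) mul1r.
have [q vq qE] := root_path_is_parent vv0.
rewrite (nonroot_neighbour_sum _ vq).
have [[d [_ _ Sv]]|[_ Sv]] := S_cases v.
  rewrite (solution_sum_pinfty qE Sv) subrr.
  by rewrite (solution_nonroot qE) ?Sv // weight_pinfty // mul0r.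
rewrite (solution_sum_fin Sv).
have [Sv1|/eqP Sv1] := eqVneq (S v) 1%:E; last first.
  have w1 := weight_fin Sv Sv1; rewrite (solution_nonroot qE) //.
  rewrite -[X in _ = X + _]mul1r -w1; ring.
(* Remaining case S(v) = 1: the parent [q] then has infinite S, so its value is 0 and the children
   of [v] alone sum to [solution v]. *)
have cqv : child e v0 q v.
  have [[esym _] _ _] := te.
  rewrite /child; apply/andP; split; first by case: vq => s [/andP[]]; rewrite esym.
  apply/asboolPn => -[s [ps us ls]].
  have [pq uq lq] := root_pathP q; have [_ uv _] := root_pathP v.
  move: uv; rewrite qE (root_path_uniq pq uq lq ps us ls).
  by rewrite /= !inE eqxx orbT.
have Sq := S_eqy cqv Sv1.
(* The root has value 1, so [q] must be shown to lie below it. *)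
have qv0 : q <> v0 by move=> qv0; rewrite qv0 S0 in Sq.
have [q' _ q'E] := root_path_is_parent qv0.
rewrite (solution_nonroot q'E) ?Sq // weight_pinfty // mul0r add0r.
by move: Sv; rewrite Sv1 => -[<-]; rewrite mul1r.
Qed.

End Values.
End RootedTreeTheory.

Theorem theorem3p1 (R : realType) (V : finType) (e : rel V) (He : tree e) :
  neighbour_sum_property R e <-> exists v0 : V, S1k R e v0 = 1%:E%E.
Proof.
split=> [[f [[v0 fv0] fS]]|[v0 S0]]; last first.
  exists (solution v0 He R); split; last exact: solution_neighbour_sum.
  by exists v0; rewrite solution_root oner_neq0.
exists v0; rewrite /S1k; have [f0 fr] := neighbour_sum_children v0 He fS v0.
have [[d [_ _ /f0 fv]]|[_ Sv]] := S_cases v0 He R v0.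
  by rewrite fv eqxx in fv0.
(* The root has no parent term, so its equation is f(v0) = S(v0) f(v0), and f(v0) cancels. *)
have := fr _ Sv; rewrite -root_neighbour_sum -fS Sv -{1}[f v0]mul1r.
by move/(mulIf fv0) => <-.
Qed.
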